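(* Let $\Gamma$ be a group that surjects onto the free group $F_2$ of rank $2$. Then there are a sequence of positive integers $(n_k)_{k=1}^\infty$ with $n_k\to\infty$ as $k\to\infty$ and a sequence of functions $f_k\colon\Gamma\to\mathrm{Sym}(n_k)$, $k\ge1$, such that for every $k\ge1$ we have $\mathrm{def}_\infty(f_k)\le\frac2k$, but $d_\infty(h_k,f_k)\ge1-\frac5k$ for every integer $N_k\ge n_k$ and every group homomorphism $h_k\colon\Gamma\to\mathrm{Sym}(N_k)$.
   Context: Write $[n]=\{1,\dots,n\}$. For integers $1\le n\le N$, $\sigma\in\mathrm{Sym}(n)$ and $\tau\in\mathrm{Sym}(N)$, put $d^H(\sigma,\tau)=d^H(\tau,\sigma)=\frac1N\left(|\{x\in[n] : \sigma(x)\ne\tau(x)\}|+(N-n)\right)$. For functions $f\colon\Gamma\to\mathrm{Sym}(n)$ and $h\colon\Gamma\to\mathrm{Sym}(N)$: $\mathrm{def}_\infty(f)=\sup\{d^H(f(\gamma_1\gamma_2),f(\gamma_1)f(\gamma_2)) : \gamma_1,\gamma_2\in\Gamma\}$ and $d_\infty(f,h)=d_\infty(h,f)=\sup\{d^H(f(\gamma),h(\gamma)) : \gamma\in\Gamma\}$. *)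

(* Defs.v *)
From HB Require Import structures.
From mathcomp Require Import all_boot all_order all_algebra all_fingroup.
From mathcomp Require Import all_classical all_reals topology.

Set Implicit Arguments.
Unset Strict Implicit.
Unset Printing Implicit Defensive.

Import Order.TTheory GRing.Theory Num.Theory.

Local Open Scope group_scope.

(** The free group on X, realised as the group of reduced words: the letter
    (x, false) is the generator x, the letter (x, true) is its inverse. *)
Section FreeGroup.
Variable X : choiceType.

Definition letter : Type := (X * bool)%type.
Implicit Types (l : letter) (u v w : seq letter).

Definition letter_inv l : letter := (l.1, ~~ l.2).

Definition reduced : pred (seq letter) :=
  sorted (fun l l' => l' != letter_inv l).

(* The reduced form of l :: w, for w reduced. *)
Definition push l w : seq letter :=
  if w is l' :: w' then if l' == letter_inv l then w' else l :: w
  else [:: l].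

Definition word_mul u v : seq letter := foldr push v u.

Definition word_inv w : seq letter := rev (map letter_inv w).

Lemma letter_invK : involutive letter_inv.
Proof. by case=> x b; rewrite /letter_inv /= negbK. Qed.

Lemma reduced_behead l w : reduced (l :: w) -> reduced w.
Proof. exact: path_sorted. Qed.

Lemma push_reduced l w : reduced w -> reduced (push l w).
Proof.
case: w => [|l' w] //= rw; case: ifP => [_|/negbT ne]; first exact: path_sorted rw.
by rewrite /= ne.
Qed.

Lemma push_cons l w : reduced (l :: w) -> push l w = l :: w.
Proof. by case: w => [|l' w] //= /andP[/negbTE->]. Qed.

Lemma pushK l w : reduced w -> push (letter_inv l) (push l w) = w.
Proof.
case: w => [|l' w] /=; first by rewrite letter_invK eqxx.
case: eqP => [-> rw|_ _] /=; last by rewrite letter_invK eqxx.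
exact: push_cons.
Qed.

Lemma word_mul_reduced u v : reduced v -> reduced (word_mul u v).
Proof. by move=> rv; elim: u => //= l u; apply: push_reduced. Qed.

Lemma word_mul_push l u v :
  reduced v -> word_mul (push l u) v = push l (word_mul u v).
Proof.
move=> rv; case: u => [|l' u] //=; case: eqP => [->|_] //=.
by rewrite -{1}[l]letter_invK pushK // word_mul_reduced.
Qed.

Lemma word_mulA u v w :
  reduced w -> word_mul u (word_mul v w) = word_mul (word_mul u v) w.
Proof. by move=> rw; elim: u => //= l u ->; rewrite word_mul_push. Qed.

Lemma word_mul0 u : reduced u -> word_mul u [::] = u.
Proof.
elim: u => //= l u IHu ru; rewrite IHu ?push_cons //; exact: reduced_behead ru.
Qed.

Lemma word_invK : involutive word_inv.
Proof.
move=> w; rewrite /word_inv map_rev revK -map_comp map_id_in // => l _.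
exact: letter_invK.
Qed.

Lemma word_inv_reduced w : reduced w -> reduced (word_inv w).
Proof.
rewrite /reduced /word_inv rev_sorted sorted_map; apply: sub_sorted => l l' /=.
by apply: contraNneq => ->; rewrite !letter_invK.
Qed.

Lemma word_mulVK u v : reduced v -> word_mul (word_inv u) (word_mul u v) = v.
Proof.
move=> rv; elim: u => //= l u IHu.
rewrite /word_inv /= rev_cons -cats1 /word_mul foldr_cat /= pushK //.
exact: word_mul_reduced.
Qed.

Lemma word_mulV u : reduced u -> word_mul (word_inv u) u = [::].
Proof. by move=> ru; rewrite -{2}(word_mul0 ru) word_mulVK. Qed.

Definition free_group : Type := {w : seq letter | reduced w}.

HB.instance Definition _ := Choice.on free_group.

Implicit Types g h k : free_group.

Definition free_one : free_group := exist _ [::] isT.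
Definition free_mul g h : free_group :=
  exist _ (word_mul (val g) (val h)) (word_mul_reduced (val g) (valP h)).
Definition free_inv g : free_group :=
  exist _ (word_inv (val g)) (word_inv_reduced (valP g)).

Lemma free_mulA : associative free_mul.
Proof. by move=> g h k; apply: val_inj; apply: word_mulA; apply: valP. Qed.

Lemma free_mul1g : left_id free_one free_mul.
Proof. by move=> g; apply: val_inj. Qed.

Lemma free_mulg1 : right_id free_one free_mul.
Proof. by move=> g; apply: val_inj; apply: word_mul0; apply: valP. Qed.

Lemma free_mulVg : left_inverse free_one free_inv free_mul.
Proof. by move=> g; apply: val_inj; apply: word_mulV; apply: valP. Qed.

Lemma free_mulgV : right_inverse free_one free_inv free_mul.
Proof.
move=> g; apply: val_inj; rewrite /= -{1}(word_invK (val g)).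
by apply: word_mulV; apply: word_inv_reduced; apply: valP.
Qed.

HB.instance Definition _ :=
  isGroup.Build free_group free_mulA free_mul1g free_mulg1 free_mulVg free_mulgV.

Definition free_gen (x : X) : free_group := exist _ [:: (x, false)] isT.

End FreeGroup.

Section FreeGroupUniversal.
Variables (X : choiceType) (G : groupType) (a : X -> G).

Definition letter_eval (l : letter X) : G := if l.2 then (a l.1)^-1 else a l.1.
Definition word_eval (w : seq (letter X)) : G :=
  foldr (fun l g => letter_eval l * g) 1 w.
Definition free_eval (g : free_group X) : G := word_eval (val g).

Lemma letter_evalV l : letter_eval (letter_inv l) = (letter_eval l)^-1.
Proof. by case: l => x [] //=; rewrite /letter_eval /= invgK. Qed.

Lemma free_evalM : {morph free_eval : g h / g * h}.
Proof.
move=> g h; rewrite /free_eval /=; elim: (val g) => [|l u IHu] /=.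
  by rewrite mul1g.
rewrite -mulgA -IHu; case: (word_mul u (val h)) => [|l' w] //=.
by case: eqP => //= ->; rewrite letter_evalV mulVKg.
Qed.

HB.instance Definition _ :=
  isMultiplicative.Build (free_group X) G free_eval free_evalM.

Lemma free_eval_gen x : free_eval (free_gen x) = a x.
Proof. by rewrite /free_eval /= mulg1. Qed.

Lemma free_eval_unique (f : {multiplicative free_group X -> G}) :
  (forall x, f (free_gen x) = a x) -> f =1 free_eval.
Proof.
move=> fa [w rw]; rewrite /free_eval /=; elim: w rw => [|l w IHw] rw.
  have -> : exist _ [::] rw = 1 :> free_group X by apply: val_inj.
  by apply: (mulgI (f 1)); rewrite -gmulfM !mulg1.
have rw' := reduced_behead rw.
have f1 : f 1 = 1 by apply: (mulgI (f 1)); rewrite -gmulfM !mulg1.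
have -> : exist _ (l :: w) rw =
    (exist _ [:: l] isT : free_group X) * (exist _ w rw' : free_group X).
  by apply: val_inj; rewrite /= push_cons.
rewrite gmulfM (IHw rw') /=; congr (_ * _).
case: l {rw} => x [] /=; last exact: fa.
apply: (mulgI (a x)); rewrite mulgV -fa -gmulfM -[RHS]f1; congr (f _).
by apply: val_inj; rewrite /= eqxx.
Qed.

End FreeGroupUniversal.

Notation F2 := (free_group 'I_2).

Section Hamming.
Variable R : realType.

Local Open Scope ring_scope.

(* d^H is symmetric by definition: for n <= N, hamming (and d_infty below) takes
   the permutation of smaller degree first. 'I_n is {0, .., n-1}, seen inside
   'I_N through widen_ord. *)
Definition hamming (n N : nat) (le_nN : (n <= N)%N) (s : 'S_n) (t : 'S_N) : R :=
  (#|[set x : 'I_n | widen_ord le_nN (s x) != t (widen_ord le_nN x)]|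
     + (N - n))%:R / N%:R.

Lemma hamming_inv (n N : nat) (le_nN : (n <= N)%N) (s : 'S_n) (t : 'S_N) :
  hamming le_nN s^-1%g t^-1%g = hamming le_nN s t.
Proof.
rewrite /hamming -(card_preimset _ (@perm_inj _ s)); congr ((_ + _)%:R / _).
apply: eq_card => x; rewrite !inE permK -(inj_eq (@perm_inj _ t)) permKV.
by rewrite eq_sym.
Qed.

Local Open Scope classical_set_scope.

(* MathComp composes permutations from left to right: (s * t)%g x = t (s x).
   By hamming_inv, replacing every f : G -> 'S_n by g |-> (f g)^-1 exchanges the
   two conventions for the product of Sym(n) and changes neither def_infty nor
   d_infty, so the left-to-right product can be used throughout. *)
Definition def_infty (G : groupType) (n : nat) (f : G -> 'S_n) : R :=
  sup [set hamming (leqnn n) (f (g.1 * g.2)%g) (f g.1 * f g.2)%g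
      | g in [set: G * G]].

Definition d_infty (G : groupType) (n N : nat) (le_nN : (n <= N)%N)
    (f : G -> 'S_n) (h : G -> 'S_N) : R :=
  sup [set hamming le_nN (f g) (h g) | g in [set: G]].

End Hamming.

(* Main.v *)
(** Send a reduced word to the product, over its maximal runs of equal letters,
    of a transposition of 'I_m.+1 determined by the length of the run. Inverse
    words have inverse images and concatenation disturbs at most one run on each
    side, so the defect is O(1/m). A homomorphism to Sym(N) kills
    a^(L 0) b^(L 1) a^(L 2) ... as soon as N! divides every L j, whereas the L j
    can be chosen so that the image of this word is an (m+1)-cycle, which moves
    every point; at this word the Hamming distance is 1. *)

Require Import Defs.
From HB Require Import structures.
From mathcomp Require Import all_boot all_order all_algebra all_fingroup.
From mathcomp Require Import all_classical all_reals topology.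
From mathcomp Require Import zify cyclic.

Set Implicit Arguments.
Unset Strict Implicit.
Unset Printing Implicit Defensive.

Import Order.TTheory GRing.Theory Num.Theory.

(** * Products over maximal runs, and concatenation *)

Section RunProduct.
Local Open Scope group_scope.
Variables (T : eqType) (G : groupType) (c : nat -> G).
Implicit Types (x y z : T) (u v w : seq T) (n : nat).

(* [c n0 * c n1 * ...] over the lengths of the maximal constant runs of
   [nseq n x ++ w], for [0 < n]. *)
Fixpoint run_prod_from x n w : G :=
  if w is y :: w' then
    if y == x then run_prod_from x n.+1 w' else c n * run_prod_from y 1 w'
  else c n.

Definition run_prod w : G := if w is x :: w' then run_prod_from x 1 w' else 1.

Lemma run_prod_from_nseq x n k : run_prod_from x n (nseq k x) = c (n + k).
Proof.
by elim: k n => [|k IHk] n /=; rewrite ?addn0 // eqxx IHk addSnnS.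
Qed.

Lemma run_prod_nseq x n : (0 < n)%N -> run_prod (nseq n x) = c n.
Proof. by case: n => // n _; rewrite /= run_prod_from_nseq. Qed.

Lemma run_prod_from_cat x n u z v : last x u != z ->
  run_prod_from x n (u ++ z :: v) = run_prod_from x n u * run_prod (z :: v).
Proof.
elim: u x n => [|y u IHu] x n /=; first by rewrite eq_sym => /negbTE->.
by case: (y == x) / eqP => [->|_] ne; rewrite IHu ?mulgA.
Qed.

(** No run straddles the junction. [x] is only the default of [last], for empty [u]. *)
Lemma run_prod_cat x u z v : x != z -> last x u != z ->
  run_prod (u ++ z :: v) = run_prod u * run_prod (z :: v).
Proof.
by case: u => [|y u] _ ne; [rewrite mul1g | apply: run_prod_from_cat].
Qed.

(** [i] counts the copies of [x] that open [v], and [g] is the product over the runs after them;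
    neither depends on [n]. *)
Lemma run_prod_from_shift x v : exists i g, forall n,
  run_prod_from x n v = c (n + i) * g.
Proof.
elim: v => [|y v [i [g IHv]]] /=; first by exists 0, 1 => n; rewrite mulg1 addn0.
case: eqP => [_|_]; last by exists 0, (run_prod_from y 1 v) => n; rewrite addn0.
by exists i.+1, g => n; rewrite IHv addSnnS.
Qed.

(** At most the two runs that meet at the junction merge. Then [c p * c q] has to become
    [c (p + q)], which [e = (c p)^-1 * c (p + q) * (c q)^-1] achieves. *)
Lemma run_prod_from_cat_approx x n u v : exists e,
    run_prod_from x n (u ++ v) = run_prod_from x n u * e * run_prod v
  /\ (e = 1 \/ exists i j l, e = (c i)^-1 * c j * (c l)^-1).
Proof.
elim: u x n => [|y u IHu] x n /=.
  case: v => [|y v] /=; first by exists 1; rewrite !mulg1; split; last left.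
  case: eqP => [->|_]; last by exists 1; rewrite mulg1; split; last left.
  have [i [g E]] := run_prod_from_shift x v.
  exists ((c n)^-1 * c (n.+1 + i) * (c (1 + i))^-1); rewrite !E.
  by split; [rewrite !mulgA mulgV mul1g mulgKV | right; do 3!eexists].
case: eqP => _; first exact: IHu.
by have [e [-> he]] := IHu y 1%N; exists e; rewrite !mulgA.
Qed.

Lemma run_prod_cat_approx u v : exists e,
    run_prod (u ++ v) = run_prod u * e * run_prod v
  /\ (e = 1 \/ exists i j l, e = (c i)^-1 * c j * (c l)^-1).
Proof.
case: u => [|x u]; last exact: run_prod_from_cat_approx.
by exists 1; rewrite !mul1g; split; last left.
Qed.

End RunProduct.

(** * Inversion and cancellation in the free group *)

Section RunProductInverse.
Local Open Scope group_scope.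
Variables (X : choiceType) (G : groupType) (c : nat -> G).
Hypothesis cV : forall n, (c n)^-1 = c n.
Implicit Types (x : letter X) (u v w : seq (letter X)).

(** Inversion reverses the order of the runs and keeps their lengths, and by [cV] each factor is its
    own inverse. The pending run of [x] appears as a final block, so that the induction can lengthen
    it. *)
Lemma run_prod_from_inv x n w :
  run_prod c (word_inv w ++ nseq n.+1 (letter_inv x)) =
  (run_prod_from c x n.+1 w)^-1.
Proof.
elim: w x n => [|y w IHw] x n; first by rewrite run_prod_nseq //= cV.
have -> : word_inv (y :: w) = word_inv w ++ nseq 1 (letter_inv y).
  by rewrite /word_inv /= rev_cons -cats1.
rewrite [RHS]/=; case: eqP => [->|/eqP ne].
  by rewrite -catA; exact: (IHw x n.+1).
have ne' : letter_inv y != letter_inv x.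
  by apply: contraNneq ne => /(can_inj (@letter_invK X))->.
rewrite invgM cV -(IHw y 0%N) -(run_prod_nseq c (letter_inv x) (ltn0Sn n)).
by apply: (@run_prod_cat _ _ _ (letter_inv y)); rewrite ?cats1 ?last_rcons.
Qed.

Lemma run_prod_inv w : run_prod c (word_inv w) = (run_prod c w)^-1.
Proof.
case: w => [|x w]; first by rewrite invg1.
by rewrite -run_prod_from_inv /word_inv /= rev_cons -cats1.
Qed.

(** A letter of [u] can cancel only after all letters to its right have; [w] is the cancelled
    suffix. *)
Lemma word_mul_cancel u v : reduced u -> exists u' w v',
  [/\ u = u' ++ w, v = word_inv w ++ v' & word_mul u v = u' ++ v'].
Proof.
elim: u => [|l u IHu] ru; first by exists [::], [::], v.
have [[|l' u'] [w [v' [Eu Ev Em]]]] := IHu (reduced_behead ru).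
  case: v' Ev Em => [|l'' v'] Ev Em /=; rewrite Em /=.
    by exists [:: l], w, [::]; split=> //; rewrite Eu.
  case: eqP => [El|_]; last by exists [:: l], w, (l'' :: v'); split=> //; rewrite Eu.
  exists [::], (l :: w), v'; split=> //; first by rewrite Eu.
  by rewrite Ev El /word_inv /= rev_cons cat_rcons.
(* Here [l] meets its neighbour [l'] from [u] itself, and [u] is reduced, so nothing more
   cancels. *)
rewrite /= Em /=; exists (l :: l' :: u'), w, v'; split=> //; first by rewrite Eu.
by move: ru; rewrite Eu /= => /andP[/negbTE-> _].
Qed.

(** The factors of [w] and [word_inv w] cancel in the product of the two values. What remains is one
    correction for each junction: in [u' ++ v'], in [u] and in [v]. *)
Lemma run_prod_mul_approx u v : reduced u -> exists s t e1 e2 e3,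
  [/\ run_prod c (word_mul u v) = s * e1 * t,
      run_prod c u * run_prod c v = s * (e2 * e3) * t
    & forall e, e \in [:: e1; e2; e3] ->
        e = 1 \/ exists i j l, e = (c i)^-1 * c j * (c l)^-1].
Proof.
move=> /(@word_mul_cancel _ v)[u' [w [v' [-> -> ->]]]].
have [e1 [E1 h1]] := run_prod_cat_approx c u' v'.
have [e2 [E2 h2]] := run_prod_cat_approx c u' w.
have [e3 [E3 h3]] := run_prod_cat_approx c (word_inv w) v'.
exists (run_prod c u'), (run_prod c v'), e1, e2, e3; split=> //.
  by rewrite E2 E3 run_prod_inv !mulgA mulgK.
by move=> e; rewrite !inE => /or3P[] /eqP->.
Qed.

End RunProductInverse.

(** * The number of points moved by a permutation *)

Section Displacement.
Local Open Scope group_scope.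
Variable T : finType.
Implicit Types s t : {perm T}.

Definition moved s := #|[set x | s x != x]|.

(** A point moved by [s * t] is moved by [s] or lies in the preimage under [s] of the support of
    [t]. *)
Lemma movedM s t : (moved (s * t) <= moved s + moved t)%N.
Proof.
rewrite [moved t]/moved -(card_preimset _ (@perm_inj _ s)).
apply: leq_trans (leq_card_setU _ _); apply: subset_leq_card.
apply/fintype.subsetP => x; rewrite !inE permM.
by case: (s x =P x) => [->|].
Qed.

Lemma movedV s : moved s^-1 = moved s.
Proof.
rewrite /moved -(card_preimset _ (@perm_inj _ s)); apply: eq_card => x.
by rewrite !inE permK eq_sym.
Qed.

Lemma moved1 : moved 1 = 0%N.
Proof. by apply: eq_card0 => x; rewrite inE perm1 eqxx. Qed.

Lemma moved_tperm x y : (moved (tperm x y) <= 2)%N.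
Proof.
apply: leq_trans (_ : #|[set x; y]| <= 2)%N; last by rewrite cards2; case: eqP.
apply: subset_leq_card; apply/fintype.subsetP => z; rewrite !inE.
by case: tpermP => [->|->|]; rewrite ?eqxx ?orbT.
Qed.

Lemma card_perm_neq s t : #|[set x | s x != t x]| = moved (s * t^-1).
Proof.
apply: eq_card => x; rewrite !inE permM -[in RHS](inj_eq (@perm_inj _ t)).
by rewrite permKV.
Qed.

End Displacement.

(** * Adjacent transpositions as the factors of runs *)

Section Transpositions.
Local Open Scope group_scope.
Variable m : nat.

Definition adj_tperm (j : nat) : 'S_m.+1 := tperm (inord j) (inord j.+1).

(** In left-to-right order, every factor of (0 1)(1 2)...(i-1 i) carries the image of 0 one step up,
    while any other [x <= i] is moved just once, down, by (x-1 x). *)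
Lemma prod_adj_tperm i (x : 'I_m.+1) : (i <= m)%N ->
  nat_of_ord ((\prod_(j < i) adj_tperm j : 'S_m.+1) x) =
  if x == 0%N :> nat then i else if (x <= i)%N then x.-1 else x.
Proof.
elim: i => [|i IHi] lt_im.
  by rewrite big_ord0 perm1; case: x => -[|x].
rewrite big_ord_recr permM; move: (IHi (ltnW lt_im)).
set y := fun_of_perm _ x => Ey.
(* [inord] defaults to 0 out of range; [i < m] excludes this for both points. *)
have vi : nat_of_ord (inord i : 'I_m.+1) = i by rewrite inordK // ltnW.
have vi1 : nat_of_ord (inord i.+1 : 'I_m.+1) = i.+1 by rewrite inordK.
rewrite /adj_tperm; case: tpermP => [Ey'|Ey'|ne1 ne2].
- move: Ey; rewrite Ey' vi vi1.
  by case: (nat_of_ord x =P 0%N) => ?; [lia|]; do 2!case: leqP => ?; lia.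
- move: Ey; rewrite Ey' vi vi1.
  by case: (nat_of_ord x =P 0%N) => ?; [lia|]; do 2!case: leqP => ?; lia.
have {}ne1 : y != i :> nat.
  by apply: contra_not_neq ne1 => E; apply: val_inj; rewrite /= vi.
have {}ne2 : y != i.+1 :> nat.
  by apply: contra_not_neq ne2 => E; apply: val_inj; rewrite /= vi1.
move: ne1 ne2; rewrite Ey.
by case: (nat_of_ord x =P 0%N) => ?; [lia|]; do 2!case: leqP => ?; lia.
Qed.

Lemma prod_adj_tperm_neq (x : 'I_m.+1) :
  (0 < m)%N -> (\prod_(j < m) adj_tperm j : 'S_m.+1) x != x.
Proof.
move=> m_gt0; apply/eqP => /(congr1 (@nat_of_ord _)).
rewrite prod_adj_tperm //; have := ltn_ord x.
by case: (nat_of_ord x =P 0%N) => ?; [|case: (leqP x m) => ?]; lia.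
Qed.

(* Every class of [logn 2 n %% m] contains multiples of any given [M > 0]. *)
Definition run_tperm (n : nat) : 'S_m.+1 := adj_tperm (logn 2 n %% m).

Lemma run_tpermV n : (run_tperm n)^-1 = run_tperm n.
Proof. exact: tpermV. Qed.

(** A correction is a product of at most three transpositions. *)
Lemma moved_run_prod_error (e : 'S_m.+1) :
  e = 1 \/ (exists i j l,
     e = (run_tperm i)^-1 * run_tperm j * (run_tperm l)^-1) ->
  (moved e <= 6)%N.
Proof.
case=> [->|[i [j [l ->]]]]; first by rewrite moved1.
rewrite !run_tpermV; apply: leq_trans (movedM _ _) _.
rewrite -[6%N]/(4 + 2)%N leq_add ?moved_tperm //.
by apply: leq_trans (movedM _ _) _; rewrite -[4%N]/(2 + 2)%N leq_add ?moved_tperm.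
Qed.

(** The common outer factors [s] and [t] do not affect the number of disagreements, which is thus
    that of [e1] and [e2 * e3]: three corrections of at most 6 points each. *)
Lemma run_prod_tperm_defect (X : choiceType) (u v : free_group X) :
  (#|[set x | run_prod run_tperm (val (u * v)%g) x !=
        (run_prod run_tperm (val u) * run_prod run_tperm (val v))%g x]| <= 18)%N.
Proof.
have [s [t [e1 [e2 [e3 [E1 E2 he]]]]]] :=
  run_prod_mul_approx run_tpermV (val v) (valP u).
rewrite [val (u * v)]/= E1 E2 -(card_preimset _ (@perm_inj _ s^-1)).
set A := _ @^-1: _; have -> : A = [set x | e1 x != (e2 * e3) x].
  apply/setP => x; rewrite !inE !(mulgA, permM) permKV.
  by rewrite (inj_eq (@perm_inj _ t)).
rewrite card_perm_neq invMg mulgA.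
have {}he e : e \in [:: e1; e2; e3] -> (moved e <= 6)%N.
  by move=> /he /moved_run_prod_error.
apply: leq_trans (movedM _ _) _; rewrite -[18%N]/(12 + 6)%N leq_add //.
  apply: leq_trans (movedM _ _) _; rewrite -[12%N]/(6 + 6)%N leq_add //.
    by rewrite he ?inE ?eqxx.
  by rewrite movedV he ?inE ?eqxx ?orbT.
by rewrite movedV he ?inE ?eqxx ?orbT.
Qed.

End Transpositions.

(** * The alternating word in powers of the two generators *)

Section PowerWord.
Local Open Scope group_scope.
Variable L : nat -> nat.
Hypothesis L_gt0 : forall i, (0 < L i)%N.

Definition gen2 (i : nat) : 'I_2 := if odd i then ord_max else ord0.

Fixpoint power_word (i : nat) : seq (letter 'I_2) :=
  if i is i'.+1 then power_word i' ++ nseq (L i') (gen2 i', false) else [::].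

Lemma positive_reduced (X : choiceType) (w : seq (letter X)) :
  all (fun l => ~~ l.2) w -> reduced w.
Proof.
case: w => //= l w; elim: w l => //= l' w IHw l /and3P[l_pos l'_pos w_pos].
rewrite IHw ?l'_pos // andbT.
by apply: contra l'_pos => /eqP->; rewrite /= l_pos.
Qed.

Lemma power_word_positive i : all (fun l => ~~ l.2) (power_word i).
Proof. by elim: i => //= i IHi; rewrite all_cat IHi all_nseq orbT. Qed.

(** Adjacent blocks are nonempty and use different generators, so the blocks are exactly the maximal
    runs. *)
Lemma run_prod_power_word (G : groupType) (c : nat -> G) i :
  run_prod c (power_word i) = \prod_(j < i) c (L j).
Proof.
elim: i => [|i IHi]; first by rewrite big_ord0.
rewrite big_ord_recr -IHi /= -(run_prod_nseq c (gen2 i, false) (L_gt0 i)).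
have := L_gt0 i; case: (L i) => // n _ /=.
apply: (@run_prod_cat _ _ _ (gen2 i.+1, false)).
  by rewrite /gen2 /=; case: (odd i).
have gne : (gen2 i.+1, false) != (gen2 i, false) :> letter 'I_2.
  by rewrite /gen2 /=; case: (odd i).
case: i {IHi} gne => [|i] gne //=; rewrite last_cat.
have := L_gt0 i; case: (L i) => // n' _ /=.
rewrite (_ : last _ _ = (gen2 i, false)); last by elim: n'.
by rewrite /gen2 /=; case: (odd i).
Qed.

Lemma word_mul_reduced_cat (X : choiceType) (u v : seq (letter X)) :
  reduced (u ++ v) -> word_mul u v = u ++ v.
Proof.
elim: u => //= l u IHu ruv; rewrite IHu ?push_cons //; exact: reduced_behead ruv.
Qed.

Lemma val_free_genX (X : choiceType) (x : X) n :
  val (free_gen x ^+ n) = nseq n (x, false).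
Proof.
elim: n => [|n IHn]; first by rewrite expg0.
rewrite expgS [LHS]/= IHn push_cons //; apply: positive_reduced.
by rewrite -[_ :: _]/(nseq n.+1 _) all_nseq orbT.
Qed.

(** [power_word] evaluated in any group: built on lifts of the generators, one element can be
    followed through two homomorphisms. *)
Fixpoint power_prod (G : groupType) (a : 'I_2 -> G) (i : nat) : G :=
  if i is i'.+1 then power_prod a i' * a (gen2 i') ^+ L i' else 1.

Lemma multiplicative1 (G H : groupType) (f : {multiplicative G -> H}) : f 1 = 1.
Proof. by apply: (mulgI (f 1)); rewrite -gmulfM !mulg1. Qed.

Lemma multiplicativeX (G H : groupType) (f : {multiplicative G -> H}) g n :
  f (g ^+ n) = f g ^+ n.
Proof.
by elim: n => [|n IHn]; rewrite ?expg0 ?multiplicative1 // !expgS gmulfM IHn.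
Qed.

Lemma multiplicative_power_prod (G H : groupType) (f : {multiplicative G -> H})
    (a : 'I_2 -> G) i : f (power_prod a i) = power_prod (f \o a) i.
Proof.
by elim: i => [|i IHi] /=; rewrite ?multiplicative1 // gmulfM multiplicativeX IHi.
Qed.

Lemma power_prod_eq1 (G : groupType) (a : 'I_2 -> G) i :
  (forall x j, a x ^+ L j = 1) -> power_prod a i = 1.
Proof. by move=> aL; elim: i => //= i ->; rewrite aL mulg1. Qed.

Lemma val_power_prod (a : 'I_2 -> F2) i :
  a =1 @free_gen _ -> val (power_prod a i) = power_word i.
Proof.
move=> aE; elim: i => //= i ->; rewrite aE val_free_genX word_mul_reduced_cat //.
exact/positive_reduced/(power_word_positive i.+1).
Qed.

End PowerWord.

(** * Bounds and special values of the Hamming distance *)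

Section Hamming.
Local Open Scope ring_scope.
Variable R : realType.

Lemma hamming_le1 (n N : nat) (le_nN : (n <= N)%N) (s : 'S_n) (t : 'S_N) :
  hamming R le_nN s t <= 1.
Proof.
have leN : (#|[set x : 'I_n | widen_ord le_nN (s x) != t (widen_ord le_nN x)]|
             + (N - n) <= N)%N.
  rewrite -[leqRHS](subnKC le_nN) leq_add2r -[leqRHS](card_ord n).
  exact: max_card.
(* For [N = 0] the quotient is 0, as division by 0 yields 0. *)
rewrite /hamming; case: N le_nN t leN => [|N] le_nN t leN.
  by rewrite invr0 mulr0.
by rewrite ler_pdivrMr ?ltr0n // mul1r ler_nat.
Qed.

(** All [n] points disagree and the other [N - n] count anyway, so the numerator is [N]. *)
Lemma hamming1_fixfree (n N : nat) (le_nN : (n <= N)%N) (s : 'S_n) :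
  (0 < n)%N -> (forall x, s x != x) -> hamming R le_nN s 1%g = 1.
Proof.
move=> n_gt0 s_fixfree; rewrite /hamming.
rewrite (_ : [set x | _] = [set: 'I_n]); last first.
  apply/setP => x; rewrite !inE perm1.
  by apply: contra_neq (s_fixfree x) => /(congr1 (@nat_of_ord _)) E; apply: val_inj.
rewrite cardsT card_ord subnKC // mulfV // pnatr_eq0 -lt0n.
exact: leq_trans n_gt0 le_nN.
Qed.

Lemma hamming_diag (n : nat) (s t : 'S_n) :
  hamming R (leqnn n) s t = #|[set x | s x != t x]|%:R / n%:R.
Proof.
rewrite /hamming subnn addn0; congr (_%:R / _); apply: eq_card => x.
have w (y : 'I_n) : widen_ord (leqnn n) y = y by apply: val_inj.
by rewrite !inE !w.
Qed.

End Hamming.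

(** * The functions on [Gamma]: defect and distance from homomorphisms *)

Local Open Scope classical_set_scope.
Local Open Scope ring_scope.

Theorem theorem1p4 (R : realType) (Gamma : groupType)
    (p : {multiplicative Gamma -> F2}) (p_surj : forall w : F2, exists g : Gamma, p g = w) :
  exists (n : nat -> nat) (f : forall k : nat, Gamma -> 'S_(n k)),
    [/\ forall k : nat, (1 <= k)%N -> (1 <= n k)%N,
        n k @[k --> \oo] --> \oo
      & forall k : nat, (1 <= k)%N ->
          def_infty R (f k) <= 2 / k%:R /\
          (forall (N : nat) (le_nN : (n k <= N)%N)
                  (h : {multiplicative Gamma -> 'S_N}),
              1 - 5 / k%:R <= d_infty R le_nN (f k) h)].
Proof.
(* The factor 9 turns the bound of 18 disagreements into 18 / (9k + 1) < 2 / k. *)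
exists (fun k => (9 * k).+1), (fun k g => run_prod (run_tperm (9 * k)) (val (p g))).
split=> //.
  apply/cvgnyPge => A; near=> k.
  have leAk : (A <= k)%N by near: k; exact: nbhs_infty_ge.
  by apply: leq_trans leAk _; lia.
move=> k k_gt0; set m := (9 * k)%N; have m_gt0 : (0 < m)%N by rewrite muln_gt0.
split.
  apply: ge_sup; first by exists (hamming R (leqnn m.+1)
    (run_prod (run_tperm m) (val (p (1 * 1)%g)))
    (run_prod (run_tperm m) (val (p 1%g)) * run_prod (run_tperm m) (val (p 1%g)))%g), (1, 1)%g.
  move=> _ [[g h] _ <-] /=.
  rewrite hamming_diag gmulfM ler_pdivrMr ?ltr0n // mulrAC ler_pdivlMr ?ltr0n //.
  rewrite -!natrM ler_nat.
  apply: leq_trans (_ : 18 * k <= _)%N; last by rewrite /m; lia.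
  by rewrite leq_mul2r run_prod_tperm_defect orbT.
move=> N le_nN h.
have /choice[a pa] : forall x : 'I_2, exists g, p g = free_gen x by move=> x; apply: p_surj.
pose M := #|[set: 'S_N]%G|.
(* The factor [M], the order of Sym(N), makes every [L j]-th power trivial there. The power of 2
   brings the 2-adic valuation to [j + m * logn 2 M], which is [j] modulo [m]. *)
pose L j := (M * 2 ^ (j + m.-1 * logn 2 M))%N.
have M_gt0 : (0 < M)%N by rewrite cardG_gt0.
have L_gt0 j : (0 < L j)%N by rewrite muln_gt0 M_gt0 expn_gt0.
have L_class j : (j < m)%N -> (logn 2 (L j) %% m)%N = j.
  move=> lt_jm; rewrite lognM ?expn_gt0 // pfactorK //.
  rewrite addnCA -mulSn prednK // mulnC addnC modnMDl.
  by rewrite modn_small.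
pose g := power_prod L a m.
have hg : h g = 1%g.
  rewrite multiplicative_power_prod power_prod_eq1 // => x j /=.
  by rewrite expgM expg_cardG ?expg1n ?inE.
have fg : run_prod (run_tperm m) (val (p g)) = (\prod_(j < m) adj_tperm m j)%g.
  rewrite multiplicative_power_prod val_power_prod // run_prod_power_word //.
  by apply: eq_bigr => j _; rewrite /run_tperm L_class.
have d1 : hamming R le_nN (run_prod (run_tperm m) (val (p g))) (h g) = 1.
  by rewrite fg hg hamming1_fixfree // => x; apply: prod_adj_tperm_neq.
apply: (@le_trans _ _ 1); first by rewrite gerBl divr_ge0.
(* The supremum dominates the value at [g] because all distances are bounded by 1. *)
rewrite -[leLHS]d1; apply: ub_le_sup; last by exists g.
by exists 1 => _ [g' _ <-]; apply: hamming_le1.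
Unshelve. all: by end_near.
Qed.
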